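(* Let $f(x)=\frac1n\sum_{i=1}^n f_i(x)+r(x)$ on $\mathbb{R}^d$, where each $f_i$ and the function $r:\mathbb{R}^d\to\mathbb{R}$ are $L$-smooth (and possibly nonconvex), and suppose $f$ has a global minimizer $x^*$. Then the IFO complexity of the algorithm REG-SAGA$(x^0,T,\eta)$ to obtain an $\epsilon$-accurate solution is $O(n+n^{2/3}/\epsilon)$. That is, for a suitable step size $\eta>0$ and every $\epsilon>0$, the number of iterations $T$ can be chosen such that the output $x_a$ satisfies $\mathbb{E}[\|\nabla f(x_a)\|^2]\le\epsilon$ and the total number of IFO calls is $O(n+n^{2/3}/\epsilon)$.
   Context: A differentiable function $h$ is $L$-smooth ($L>0$) if $\|\nabla h(x)-\nabla h(y)\|\le L\|x-y\|$ for all $x,y\in\mathbb{R}^d$. Write $[n]=\{1,\dots,n\}$. Algorithm REG-SAGA$(x^0,T,\eta)$, with $x^0\in\mathbb{R}^d$, an integer $T\ge 1$ and step size $\eta>0$ (which may depend on $L$ and $n$): set $\alpha_i^0=x^0$ for all $i\in[n]$ and $g^0=\frac1n\sum_{i=1}^n\nabla f_i(\alpha_i^0)$. For $t=0,\dots,T-1$: pick $i_t,j_t$ uniformly at random from $[n]$ (independently of each other and of the past); set $v^t=\nabla f_{i_t}(x^t)-\nabla f_{i_t}(\alpha_{i_t}^t)+g^t$; set $x^{t+1}=x^t-\eta(v^t+\nabla r(x^t))$; set $\alpha_{j_t}^{t+1}=x^t$ and $\alpha_j^{t+1}=\alpha_j^t$ for $j\ne j_t$; set $g^{t+1}=g^t-\frac1n(\nabla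 f_{j_t}(\alpha_{j_t}^t)-\nabla f_{j_t}(\alpha_{j_t}^{t+1}))$. Output $x_a$ chosen uniformly at random from $\{x^t\}_{t=0}^{T-1}$. Expectations are over all the randomness. An incremental first-order oracle (IFO) call takes $i\in[n]$ and $x\in\mathbb{R}^d$ and returns $(f_i(x),\nabla f_i(x))$. The gradients $\nabla f_i(\alpha_i^t)$ are kept in memory, so the algorithm uses $n$ IFO calls to initialize and $O(1)$ IFO calls per iteration; evaluations of $\nabla r$ are performed directly. The IFO complexity is the number of IFO calls used. In $O(\cdot)$, the quantities $L$ and $f(x^0)-f(x^* )$ are treated as constants independent of $n$ and $\epsilon$ (the hidden constant may depend on them only). *)

(* Defs.v *)
From HB Require Import structures.
From mathcomp Require Import all_boot all_order all_algebra.
From mathcomp Require Import all_classical all_reals all_analysis.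
Set Implicit Arguments.
Unset Strict Implicit.
Unset Printing Implicit Defensive.
Import Order.TTheory GRing.Theory Num.Theory.
Import numFieldNormedType.Exports.
Local Open Scope ring_scope.

(* The norm `|x| that the library puts on 'rV[R]_d is the maximum norm. The two
   norms are equivalent, so the library's differentiability is the usual one. *)
Definition enorm (R : realType) (d : nat) (x : 'rV[R]_d) : R :=
  Num.sqrt (\sum_(k < d) x 0 k ^+ 2).

Definition gradient (R : realType) (d : nat) (h : 'rV[R]_d -> R) (x : 'rV[R]_d)
    : 'rV[R]_d :=
  \row_(k < d) 'D_(delta_mx 0 k) h x.

Definition L_smooth (R : realType) (d : nat) (L : R) (h : 'rV[R]_d -> R) : Prop :=
  (forall x, differentiable h x) /\
  forall x y, enorm (gradient h x - gradient h y) <= L * enorm (x - y).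

Definition objective (R : realType) (n d : nat) (fs : 'I_n -> 'rV[R]_d -> R)
    (r : 'rV[R]_d -> R) (x : 'rV[R]_d) : R :=
  n%:R^-1 * \sum_(i < n) fs i x + r x.

(* Programs with access to an oracle answering queries in Q by elements of S;
   the number of oracle calls is read off an execution. *)
Inductive prog (Q S A : Type) : Type :=
| Ret of A
| Query of Q & (S -> prog Q S A).
Arguments Ret {Q S A} a.

Fixpoint bind (Q S A B : Type) (p : prog Q S A) (k : A -> prog Q S B)
    : prog Q S B :=
  match p with
  | Ret a => k a
  | Query q c => Query q (fun s => bind (c s) k)
  end.

Fixpoint result (Q S A : Type) (oracle : Q -> S) (p : prog Q S A) : A :=
  match p with
  | Ret a => a
  | Query q c => result oracle (c (oracle q))
  end.

Fixpoint calls (Q S A : Type) (oracle : Q -> S) (p : prog Q S A) : nat :=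
  match p with
  | Ret _ => 0
  | Query q c => (calls oracle (c (oracle q))).+1
  end.

Definition IFO (R : realType) (n d : nat) (fs : 'I_n -> 'rV[R]_d -> R)
    (q : 'I_n * 'rV[R]_d) : R * 'rV[R]_d :=
  (fs q.1 q.2, gradient (fs q.1) q.2).

Definition ifo_prog (R : realType) (n d : nat) (A : Type) : Type :=
  prog ('I_n * 'rV[R]_d)%type (R * 'rV[R]_d)%type A.

(* [st_grad s i] is the copy of grad f_i (alpha_i) kept in memory, obtained from
   an earlier oracle call; see [saga_init_mem] and [saga_step_mem] below. *)
Record saga_state (R : realType) (n d : nat) := SagaState {
  st_x : 'rV[R]_d;
  st_alpha : 'I_n -> 'rV[R]_d;
  st_grad : 'I_n -> 'rV[R]_d;
  st_g : 'rV[R]_d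
}.

Fixpoint query_gradients (R : realType) (n d : nat) (x : 'rV[R]_d)
    (s : seq 'I_n) (mem : 'I_n -> 'rV[R]_d)
    : ifo_prog R n d ('I_n -> 'rV[R]_d) :=
  match s with
  | [::] => Ret mem
  | i :: s' => Query (i, x) (fun ans =>
      query_gradients x s' [eta mem with i |-> ans.2])
  end.

Definition saga_init (R : realType) (n d : nat) (x0 : 'rV[R]_d)
    : ifo_prog R n d (saga_state R n d) :=
  bind (query_gradients x0 (enum 'I_n) (fun=> 0)) (fun mem =>
    Ret (SagaState x0 (fun=> x0) mem (n%:R^-1 *: \sum_(i < n) mem i))).

Definition saga_step (R : realType) (n d : nat) (grad_r : 'rV[R]_d -> 'rV[R]_d)
    (eta : R) (s : saga_state R n d) (ij : 'I_n * 'I_n)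
    : ifo_prog R n d (saga_state R n d) :=
  let: (i, j) := ij in
  let x := st_x s in
  Query (i, x) (fun ans_i =>
  Query (j, x) (fun ans_j =>
    let v := ans_i.2 - st_grad s i + st_g s in
    Ret (SagaState
      (x - eta *: (v + grad_r x))
      [eta st_alpha s with j |-> x]
      [eta st_grad s with j |-> ans_j.2]
      (st_g s - n%:R^-1 *: (st_grad s j - ans_j.2))))).

(* Started at x^0 with T = size w picks, returns x^0, ..., x^(T-1); the T-th
   update is performed (and its oracle calls counted) as well. *)
Fixpoint saga_loop (R : realType) (n d : nat) (grad_r : 'rV[R]_d -> 'rV[R]_d)
    (eta : R) (s : saga_state R n d) (w : seq ('I_n * 'I_n))
    : ifo_prog R n d (seq 'rV[R]_d) :=
  match w with
  | [::] => Ret [::]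
  | ij :: w' =>
      bind (saga_step grad_r eta s ij) (fun s' =>
      bind (saga_loop grad_r eta s' w') (fun xs => Ret (st_x s :: xs)))
  end.

(* All the randomness of T iterations: the picks (i_t, j_t) for t < T, and the
   index a of the output iterate. *)
Definition saga_random (n T : nat) : finType :=
  (T.-tuple ('I_n * 'I_n) * 'I_T)%type.

Definition reg_saga (R : realType) (n d : nat) (grad_r : 'rV[R]_d -> 'rV[R]_d)
    (x0 : 'rV[R]_d) (T : nat) (eta : R) (w : saga_random n T)
    : ifo_prog R n d 'rV[R]_d :=
  bind (saga_init n x0) (fun s =>
  bind (saga_loop grad_r eta s w.1) (fun xs => Ret (nth x0 xs w.2))).

(* Expectation under the uniform distribution on W. For W = saga_random n T this
   makes all the i_t, the j_t and a independent and uniform. *)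
Definition unif_mean (R : realType) (W : finType) (X : W -> R) : R :=
  (\sum_(w : W) X w) / #|W|%:R.

Lemma saga_init_mem (R : realType) (n d : nat) (fs : 'I_n -> 'rV[R]_d -> R)
    (x0 : 'rV[R]_d) (i : 'I_n) :
  let s := result (IFO fs) (saga_init n x0) in
  st_grad s i = gradient (fs i) (st_alpha s i).
Proof.
rewrite /saga_init.
have qE : forall (l : seq 'I_n) mem,
  result (IFO fs) (bind (query_gradients x0 l mem) (fun mem =>
    Ret (SagaState x0 (fun=> x0) mem (n%:R^-1 *: \sum_(i < n) mem i)))) =
  let mem' := result (IFO fs) (query_gradients x0 l mem) in
  SagaState x0 (fun=> x0) mem' (n%:R^-1 *: \sum_(i < n) mem' i).
  by elim=> [//|k l IHl] mem /=; rewrite IHl.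
rewrite qE /=.
have memE : forall (l : seq 'I_n) mem,
  result (IFO fs) (query_gradients x0 l mem) i =
  if i \in l then gradient (fs i) x0 else mem i.
  elim=> [//|k l IHl] mem /=; rewrite IHl inE /=.
  by case: eqP => [->|]; case: (_ \in l).
by rewrite memE mem_enum.
Qed.

Lemma saga_step_mem (R : realType) (n d : nat) (fs : 'I_n -> 'rV[R]_d -> R)
    (grad_r : 'rV[R]_d -> 'rV[R]_d) (eta : R) (s : saga_state R n d)
    (ij : 'I_n * 'I_n) :
  (forall i, st_grad s i = gradient (fs i) (st_alpha s i)) ->
  let s' := result (IFO fs) (saga_step grad_r eta s ij) in
  forall i, st_grad s' i = gradient (fs i) (st_alpha s' i).
Proof.
by case: ij => i j sE s' k; rewrite /s' /=; case: eqP => [->|].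
Qed.

(* Main.v *)
(** Every quantity is a finite sum over the picks, so no probability theory is
    needed. With [q = n^(1/3)] and step size [1/(4 L q^2)], the potential
    [objective (x) + L/(8 q) * mean_k |x - alpha_k|^2] loses on average over the
    next pick [(i, j)] at least [eta/2 * |gradient objective (x)|^2]: the descent
    inequality bounds the objective after the step, the variance of the SAGA
    estimator is at most [L^2 * mean_k |x - alpha_k|^2], and refreshing one
    [alpha_j] contracts the mean distance by the factor [1 - 1/n]. The potential
    starts at [objective x0] and never goes below the minimum, so the average
    squared gradient norm over [T] iterations is at most
    [8 L Delta n^(2/3) / T]. *)

Require Import Defs.
From HB Require Import structures.
From mathcomp Require Import all_boot all_order all_algebra.
From mathcomp Require Import all_classical all_reals all_analysis.
From mathcomp Require Import ring lra.
Import Order.TTheory GRing.Theory Num.Theory.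
Import numFieldNormedType.Exports.
Local Open Scope ring_scope.

(** * The Euclidean inner product *)

(* Locked because rewriting lemmas on [\sum] would otherwise unfold it. *)
HB.lock Definition dotv {R : realType} {d : nat} (u v : 'rV[R]_d) : R :=
  \sum_(k < d) u 0 k * v 0 k.

Lemma dotvC {R : realType} {d : nat} (u v : 'rV[R]_d) : dotv u v = dotv v u.
Proof. by rewrite !dotv.unlock; apply: eq_bigr => k _; rewrite mulrC. Qed.

Lemma dotvDl {R : realType} {d : nat} (u v w : 'rV[R]_d) :
  dotv (u + v) w = dotv u w + dotv v w.
Proof.
by rewrite !dotv.unlock -big_split; apply: eq_bigr => k _; rewrite mxE mulrDl.
Qed.

Lemma dotvZl {R : realType} {d : nat} (a : R) (u v : 'rV[R]_d) :
  dotv (a *: u) v = a * dotv u v.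
Proof.
by rewrite !dotv.unlock big_distrr; apply: eq_bigr => k _; rewrite mxE -mulrA.
Qed.

Lemma dotvNl {R : realType} {d : nat} (u v : 'rV[R]_d) :
  dotv (- u) v = - dotv u v.
Proof. by rewrite -scaleN1r dotvZl mulN1r. Qed.

Lemma dotvDr {R : realType} {d : nat} (u v w : 'rV[R]_d) :
  dotv w (u + v) = dotv w u + dotv w v.
Proof. by rewrite dotvC dotvDl !(dotvC w). Qed.

Lemma dotvZr {R : realType} {d : nat} (a : R) (u v : 'rV[R]_d) :
  dotv u (a *: v) = a * dotv u v.
Proof. by rewrite dotvC dotvZl dotvC. Qed.

Lemma dotvNr {R : realType} {d : nat} (u v : 'rV[R]_d) :
  dotv u (- v) = - dotv u v.
Proof. by rewrite dotvC dotvNl dotvC. Qed.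

Definition dotvE := (@dotvDl, @dotvDr, @dotvNl, @dotvNr, @dotvZl, @dotvZr).

Lemma dotv_suml {R : realType} {d : nat} (I : finType) (F : I -> 'rV[R]_d)
    (v : 'rV[R]_d) :
  dotv (\sum_i F i) v = \sum_i dotv (F i) v.
Proof.
under [RHS]eq_bigr do rewrite dotv.unlock.
rewrite dotv.unlock exchange_big; apply: eq_bigr => k _.
by rewrite summxE mulr_suml.
Qed.

Lemma dotvv_ge0 {R : realType} {d : nat} (u : 'rV[R]_d) : 0 <= dotv u u.
Proof. by rewrite dotv.unlock; apply: sumr_ge0 => k _; rewrite -expr2 sqr_ge0. Qed.

Lemma enorm_ge0 {R : realType} {d : nat} (u : 'rV[R]_d) : 0 <= enorm u.
Proof. exact: sqrtr_ge0. Qed.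

Lemma sqr_enorm {R : realType} {d : nat} (u : 'rV[R]_d) :
  enorm u ^+ 2 = dotv u u.
Proof.
rewrite dotv.unlock sqr_sqrtr; last by apply: sumr_ge0 => k _; exact: sqr_ge0.
by apply: eq_bigr => k _; rewrite expr2.
Qed.

(** Expand the nonnegative square of [b *: u - v] and divide by [b]. *)
Lemma dotv_young {R : realType} {d : nat} (b : R) (u v : 'rV[R]_d) : 0 < b ->
  2 * dotv u v <= b * dotv u u + b^-1 * dotv v v.
Proof.
move=> b_gt0; have := dotvv_ge0 (b *: u - v); rewrite !dotvE (dotvC v u) => h.
rewrite -(ler_pM2l b_gt0) mulrDr !mulrA divff ?gt_eqF// mul1r.
nra.
Qed.

(** * Gradients and the descent inequality for smooth functions *)

Lemma L_smooth_sqr {R : realType} {d : nat} (L : R) (h : 'rV[R]_d -> R)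
    (x y : 'rV[R]_d) : 0 < L -> L_smooth L h ->
  dotv (gradient h x - gradient h y) (gradient h x - gradient h y)
    <= L ^+ 2 * dotv (x - y) (x - y).
Proof.
move=> L_gt0 [_ /(_ x y) hxy]; rewrite -!sqr_enorm -exprMn.
by rewrite lerXn2r// nnegrE ?mulr_ge0 ?enorm_ge0// ltW.
Qed.

(** The differential is linear, so it is determined by its values on the standard basis, which are
    the entries of the gradient. *)
Lemma derive_gradient {R : realType} {d : nat} (h : 'rV[R]_d -> R)
    (x v : 'rV[R]_d) : differentiable h x -> 'D_v h x = dotv (gradient h x) v.
Proof.
move=> dh; rewrite deriveE// {1}(row_sum_delta v) linear_sum dotv.unlock.
apply: eq_bigr => k _; rewrite linearZ /= mxE -deriveE//.
by rewrite mulrC.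
Qed.

Lemma gradient_objective {R : realType} {n d : nat}
    (fs : 'I_n -> 'rV[R]_d -> R) (r : 'rV[R]_d -> R) (x : 'rV[R]_d) :
  (forall i, differentiable (fs i) x) -> differentiable r x ->
  gradient (objective fs r) x =
    n%:R^-1 *: \sum_(i < n) gradient (fs i) x + gradient r x.
Proof.
move=> dfs dr; apply/rowP => k; rewrite !mxE summxE.
have -> : objective fs r = n%:R^-1 \*: (\sum_(i < n) fs i) + r.
  by apply/funext => y; rewrite /objective !fctE fct_sumE.
have df i : derivable (fs i) x 'e_k by exact: diff_derivable.
rewrite deriveD; last exact: diff_derivable; last first.
  by apply: derivableZ; exact: derivable_sum.
rewrite deriveZ; last exact: derivable_sum.
rewrite derive_sum//; congr (_ * _ + _).
by apply: eq_bigr => i _; rewrite mxE.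
Qed.

Lemma is_derive_line {R : realType} {d : nat} (h : 'rV[R]_d -> R)
    (x v : 'rV[R]_d) (t : R) : differentiable h (x + t *: v) ->
  is_derive t 1 (fun s : R => h (x + s *: v))
    (dotv (gradient h (x + t *: v)) v).
Proof.
move=> dh.
have lineE : (fun e : R => e^-1 *: (((fun s : R => h (x + s *: v)) \o shift t)
      (e *: 1) - h (x + t *: v))) =
    (fun e : R => e^-1 *: ((h \o shift (x + t *: v)) (e *: v)
      - h (x + t *: v))).
  apply/funext => e /=; congr (_ *: (h _ - _)).
  by rewrite [e *: 1]mulr1 scalerDl addrCA.
have dv : derivable h (x + t *: v) v by exact: diff_derivable.
apply: DeriveDef; first by rewrite /derivable lineE.
by rewrite -derive_gradient// /derive lineE.
Qed.

(** The mean value theorem replaces integration along the segment: [psi], the restriction of [h] to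
    the line minus the claimed quadratic bound (up to a constant), has nonpositive slope at the
    intermediate point, so [psi 1 <= psi 0]. *)
Lemma descent {R : realType} {d : nat} (L : R) (h : 'rV[R]_d -> R)
    (x v : 'rV[R]_d) : 0 < L -> L_smooth L h ->
  h (x + v) <= h x + dotv (gradient h x) v + L / 2 * dotv v v.
Proof.
move=> L_gt0 sh; have [dh _] := sh.
set p := dotv (gradient h x) v; set q := dotv v v.
pose psi : R -> R := (fun t => h (x + t *: v)) -
  (p *: id + (L / 2 * q) *: (id : R -> R) ^+ 2).
have dpsi (t : R) : is_derive t 1 psi
    (dotv (gradient h (x + t *: v)) v - (p + L * q * t)).
  have dht := is_derive_line h x v t (dh (x + t *: v)).
  have dsq : is_derive t 1 ((id : R -> R) ^+ 2) _ :=
    is_deriveX 2 (is_derive_id t 1).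
  have dp := is_deriveZ p (is_derive_id t (1 : R)).
  have dq := is_deriveZ (L / 2 * q) dsq.
  apply: (is_derive_eq (is_deriveB dht (is_deriveD dp dq))).
  rewrite /GRing.scale /= !mulr1 /=.
  by congr (_ - (_ + _)); field.
have cpsi : {within `[0, 1], continuous psi}%classic.
  apply: derivable_within_continuous => u _.
  exact: (@ex_derive _ _ _ _ _ _ _ (dpsi u)).
have [c c01 psiE] := @MVT R psi _ 0 1 ltr01 (fun t _ => dpsi t) cpsi.
have c_gt0 : 0 < c by rewrite in_itv /= in c01; case/andP: c01.
set w := gradient h (x + c *: v) - gradient h x.
have wle : dotv w w <= L ^+ 2 * c ^+ 2 * q.
  have := L_smooth_sqr L h (x + c *: v) x L_gt0 sh.
  rewrite -/w [x + _]addrC addrK dotvZl dotvZr -/q => h1.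
  suff <- : L ^+ 2 * (c * (c * q)) = L ^+ 2 * c ^+ 2 * q by [].
  by ring.
(* The weight [(L * c)^-1] balances the two sides: each is at most [L * c * q], which gives the
   Cauchy-Schwarz bound without square roots. *)
have young := dotv_young (L * c)^-1 w v _.
rewrite invr_gt0 mulr_gt0// invrK -/q in young.
move: (young isT) => {}young.
have wv : dotv w v <= L * q * c.
  have : (L * c)^-1 * dotv w w <= L * c * q.
    rewrite ler_pdivrMl ?mulr_gt0//; apply: le_trans wle _.
    by rewrite le_eqVlt; apply/orP; left; apply/eqP; ring.
  lra.
move: psiE; rewrite /psi !fctE /= scale1r scale0r addr0 /GRing.scale /=.
rewrite /w !dotvE -/p in wv *.
lra.
Qed.

(** * Finite averages over the indices *)

Lemma sumr_const_ord {R : pzSemiRingType} (n : nat) (c : R) :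
  \sum_(i < n) c = n%:R * c.
Proof. by rewrite sumr_const card_ord mulr_natl. Qed.

(** The quadratic coefficient is [L], not [L / 2], because the mean of the [fs i] and the
    regularizer [r] contribute [L / 2] each. *)
Lemma objective_descent {R : realType} {n d : nat} (L : R)
    (fs : 'I_n -> 'rV[R]_d -> R) (r : 'rV[R]_d -> R) (x v : 'rV[R]_d) :
  0 < L -> (0 < n)%N -> (forall i, L_smooth L (fs i)) -> L_smooth L r ->
  objective fs r (x + v) <=
    objective fs r x + dotv (gradient (objective fs r) x) v + L * dotv v v.
Proof.
move=> L_gt0 n_gt0 sfs sr; have n_neq0 : n%:R != 0 :> R by rewrite pnatr_eq0 -lt0n.
rewrite gradient_objective; [|by move=> i; apply: (sfs i).1|exact: sr.1].
rewrite dotvDl dotvZl dotv_suml /objective.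
have fsle : n%:R^-1 * \sum_(i < n) fs i (x + v) <= n%:R^-1 *
    (\sum_(i < n) fs i x + \sum_(i < n) dotv (gradient (fs i) x) v
      + n%:R * (L / 2 * dotv v v)).
  rewrite ler_pM2l ?invr_gt0 ?ltr0n// -!big_split /=.
  rewrite -[n%:R * _]sumr_const_ord -big_split /=.
  by apply: ler_sum => i _; exact: (descent L (fs i) x v L_gt0 (sfs i)).
have rle := descent L r x v L_gt0 sr.
rewrite !mulrDr mulKf// in fsle.
lra.
Qed.

(* A second moment bounds a variance: the mean of |a i - mean a|^2 is at most
   the mean of |a i|^2. *)
Lemma sum_dotv_shift_le {R : realType} {n d : nat} (a : 'I_n -> 'rV[R]_d)
    (b m : 'rV[R]_d) : \sum_i (a i + b) = n%:R *: m ->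
  \sum_i dotv (a i + b) (a i + b) <= \sum_i dotv (a i) (a i) + n%:R * dotv m m.
Proof.
rewrite big_split sumr_const card_ord /= -scaler_nat => abE.
have saE : \sum_i a i = n%:R *: (m - b) by rewrite scalerBr -abE addrK.
have -> : \sum_i dotv (a i + b) (a i + b) = \sum_i dotv (a i) (a i)
    + 2 * dotv (\sum_i a i) b + n%:R * dotv b b.
  rewrite dotv_suml mulr_sumr -[n%:R * _]sumr_const_ord.
  rewrite -!big_split /=; apply: eq_bigr => i _ /=.
  by rewrite !dotvE (dotvC b); ring.
(* After expansion, this term is exactly the gap between the two sides. *)
have h : 0 <= n%:R * dotv (m - b) (m - b) by rewrite mulr_ge0 ?dotvv_ge0.
rewrite saE !dotvE; rewrite !dotvE (dotvC b m) in h.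
lra.
Qed.

(** Models the refresh of one stored point: each [k] is hit by exactly one [j] and left alone by the
    other [n - 1]. *)
Lemma sum_if_eq {R : realType} {n : nat} (A : R) (B : 'I_n -> R) :
  \sum_j \sum_k (if k == j then A else B k) =
    n%:R * A + (n%:R - 1) * \sum_k B k.
Proof.
have -> : \sum_j \sum_k (if k == j then A else B k) =
    \sum_j (A + (\sum_k B k - B j)).
  apply: eq_bigr => j _; rewrite (bigD1 j)//= eqxx (bigD1 j (F := B))//=.
  rewrite [B j + _]addrC addrK; congr (_ + _).
  by apply: eq_bigr => k /negbTE ->.
rewrite big_split sumrB /= !sumr_const_ord.
by ring.
Qed.

(** * Decrease of the potential in one step *)

(** The invariant behind unbiasedness: with [st_g] the mean of the stored gradients, the stored
    terms cancel when the direction is averaged over [i]. *)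
Definition saga_mem_ok {R : realType} {n d : nat} (fs : 'I_n -> 'rV[R]_d -> R)
    (s : saga_state R n d) : Prop :=
  (forall k, st_grad s k = gradient (fs k) (st_alpha s k)) /\
  st_g s = n%:R^-1 *: \sum_k st_grad s k.

Lemma saga_step_ok {R : realType} {n d : nat} (fs : 'I_n -> 'rV[R]_d -> R)
    (grad_r : 'rV[R]_d -> 'rV[R]_d) (eta : R) (s : saga_state R n d)
    (ij : 'I_n * 'I_n) : saga_mem_ok fs s ->
  saga_mem_ok fs (result (IFO fs) (saga_step grad_r eta s ij)).
Proof.
move=> [memE gE]; split; first exact: saga_step_mem.
case: ij => i j /=; rewrite gE -scalerBr; congr (_ *: _).
rewrite (bigD1 j)//= [RHS](bigD1 j)//= eqxx.
rewrite opprB [LHS]addrC [LHS]addrA subrK; congr (_ + _).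
by apply: eq_bigr => k /negbTE ->.
Qed.

Definition potential {R : realType} {n d : nat} (fs : 'I_n -> 'rV[R]_d -> R)
    (r : 'rV[R]_d -> R) (c : R) (s : saga_state R n d) : R :=
  objective fs r (st_x s) +
    c / n%:R * \sum_k dotv (st_x s - st_alpha s k) (st_x s - st_alpha s k).

(* [beta] is the weight of Young's inequality applied to the cross term between
   the gradient and [x - alpha_k]. A weight [c] constant in time is enough: the
   contraction rate [1/n] dominates [eta * beta = 1/(4 n)]. *)
Lemma saga_rates {R : realType} (L q : R) : 0 < L -> 1 <= q ->
  let n := q ^+ 3 in let eta := (4 * L * q ^+ 2)^-1 in
  let beta := L / q in let c := L / (8 * q) in
  n * L * eta ^+ 2 * L ^+ 2 +
    c * (n * eta ^+ 2 * L ^+ 2 + (n - 1) * (1 + eta * beta)) <= c * n /\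
  L * eta ^+ 2 + c * eta ^+ 2 + c * (eta / beta) <= eta / 2.
Proof.
move=> L_gt0 q_ge1 n eta beta c; have q_gt0 : 0 < q by lra.
have [L_neq0 q_neq0] : L != 0 /\ q != 0 by rewrite !gt_eqF.
set p := q^-1; have p_gt0 : 0 < p by rewrite invr_gt0.
have p_le1 : p <= 1 by rewrite invf_le1.
have [p2_le1 p3_le1] : p ^+ 2 <= 1 /\ p ^+ 3 <= 1 by split; rewrite exprn_ile1// ltW.
have p3_ge0 : 0 <= p ^+ 3 by rewrite exprn_ge0 ?ltW.
(* The first inequality controls the coefficient of the squared distances, the second that of the
   squared gradient. In terms of [p = 1 / q], each slack is a positive factor times a sum of terms
   nonnegative on [0 < p <= 1]. *)
split; rewrite -subr_ge0.
  have -> : c * n - (n * L * eta ^+ 2 * L ^+ 2 +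
      c * (n * eta ^+ 2 * L ^+ 2 + (n - 1) * (1 + eta * beta))) =
      L * p * (32^-1 * (1 - p) + 3 / 128 * p + 32^-1 * p ^+ 3).
    by rewrite /c /n /eta /beta /p; field; rewrite L_neq0 q_neq0.
  by rewrite mulr_ge0 ?mulr_ge0 ?(ltW L_gt0) ?(ltW p_gt0)//; lra.
have -> : eta / 2 - (L * eta ^+ 2 + c * eta ^+ 2 + c * (eta / beta)) =
    p ^+ 2 / L * (3 / 128 + 16^-1 * (1 - p ^+ 2) + 128^-1 * (1 - p ^+ 3)).
  by rewrite /c /eta /beta /p; field; rewrite L_neq0 q_neq0.
by rewrite mulr_ge0 ?divr_ge0 ?sqr_ge0 ?(ltW L_gt0)//; lra.
Qed.

Lemma potential_step {R : realType} {n d : nat} (L q : R)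
    (fs : 'I_n -> 'rV[R]_d -> R) (r : 'rV[R]_d -> R) (s : saga_state R n d) :
  0 < L -> (0 < n)%N -> 1 <= q -> q ^+ 3 = n%:R ->
  (forall i, L_smooth L (fs i)) -> L_smooth L r -> saga_mem_ok fs s ->
  \sum_ij potential fs r (L / (8 * q))
      (result (IFO fs)
        (saga_step (gradient r) (4 * L * q ^+ 2)^-1 s ij)) <=
    n%:R ^+ 2 * (potential fs r (L / (8 * q)) s - (4 * L * q ^+ 2)^-1 / 2 *
      enorm (gradient (objective fs r) (st_x s)) ^+ 2).
Proof.
move=> L_gt0 n_gt0 q_ge1 qE sfs sr [memE gE]; rewrite sqr_enorm.
set eta := (4 * L * q ^+ 2)^-1; pose x := st_x s.
set F := gradient (objective fs r) (st_x s).
have n_neq0 : n%:R != 0 :> R by rewrite pnatr_eq0 -lt0n.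
have n_ge1 : 1 <= n%:R :> R by rewrite ler1n.
have q_gt0 : 0 < q by lra.
have eta_gt0 : 0 < eta by rewrite invr_gt0 !mulr_gt0.
have := saga_rates L q L_gt0 q_ge1; rewrite /= qE -/eta.
set beta := L / q; set c := L / (8 * q) => -[rateA rateG].
have beta_gt0 : 0 < beta by rewrite divr_gt0.
have c_gt0 : 0 < c by rewrite divr_gt0 ?mulr_gt0.
set D := fun k => x - st_alpha s k.
(* [u i] is the full update direction for the pick [i]; only [a i] depends on the pick. *)
pose a i := gradient (fs i) x - st_grad s i.
pose u i := a i + (st_g s + gradient r x).
pose U := \sum_i dotv (u i) (u i); pose A := \sum_k dotv (D k) (D k).
set G := dotv F F; have G_ge0 : 0 <= G by exact: dotvv_ge0.
have A_ge0 : 0 <= A by apply: sumr_ge0 => k _; exact: dotvv_ge0.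
have uE : \sum_i u i = n%:R *: F.
  rewrite /F gradient_objective; [|by move=> i; apply: (sfs i).1|exact: sr.1].
  rewrite /u big_split sumr_const card_ord /= sumrB gE -scaler_nat.
  by rewrite !scalerDr !scalerA divff// !scale1r addrA subrK.
have U_le : U <= n%:R * G + L ^+ 2 * A.
  apply: le_trans (sum_dotv_shift_le _ _ _ uE) _; rewrite addrC lerD2l mulr_sumr.
  apply: ler_sum => k _; rewrite /a memE.
  exact: (L_smooth_sqr L (fs k) x (st_alpha s k) L_gt0 (sfs k)).
have uiE i : u i = gradient (fs i) x - st_grad s i + st_g s + gradient r x.
  by rewrite /u addrA.
have FE : gradient (objective fs r) x = F by [].
have DE k : D k = x - st_alpha s k by [].
have AE : \sum_k dotv (x - st_alpha s k) (x - st_alpha s k) = A by [].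
clearbody u D F.
(* By unbiasedness ([uE]) the linear terms of the descent inequality sum to a multiple of [G]. *)
have obj_le : \sum_i objective fs r (x - eta *: u i) <=
    n%:R * objective fs r x - eta * n%:R * G + L * eta ^+ 2 * U.
  have -> : n%:R * objective fs r x - eta * n%:R * G + L * eta ^+ 2 * U =
      \sum_i (objective fs r x - eta * dotv F (u i)
        + L * eta ^+ 2 * dotv (u i) (u i)).
    rewrite 2!big_split /= sumr_const_ord sumrN -!mulr_sumr.
    congr (_ - _ + _); rewrite -mulrA; congr (_ * _).
    by rewrite -dotvZl -uE dotv_suml; apply: eq_bigr => i _; rewrite dotvC.
  apply: ler_sum => i _.
  apply: le_trans (objective_descent _ _ _ _ _ L_gt0 n_gt0 sfs sr) _.
  by rewrite FE !dotvE le_eqVlt; apply/orP; left; apply/eqP; ring.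
(* Averaging over [i] turns the cross term into the inner product of [F] and [D k], which Young's
   inequality with weight [beta] splits. *)
have dist_le k : \sum_i dotv (D k - eta *: u i) (D k - eta *: u i) <=
    eta ^+ 2 * U + n%:R * ((1 + eta * beta) * dotv (D k) (D k) + eta / beta * G).
  have -> : \sum_i dotv (D k - eta *: u i) (D k - eta *: u i) =
      eta ^+ 2 * U + n%:R * dotv (D k) (D k) - 2 * eta * dotv (\sum_i u i) (D k).
    rewrite dotv_suml !mulr_sumr -[n%:R * _]sumr_const_ord.
    rewrite -big_split -sumrB; apply: eq_bigr => i _ /=.
    by rewrite !dotvE (dotvC (u i)); ring.
  rewrite uE dotvZl.
  have := dotv_young beta (D k) (- F) beta_gt0.
  rewrite !dotvE opprK -/G (dotvC (D k)) => y.
  have := ler_wpM2l (ltW (mulr_gt0 eta_gt0 (lt_le_trans ltr01 n_ge1))) y.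
  lra.
(* A refreshed point ([k == j]) becomes the old iterate, at displacement [eta *: u i] from the new
   one up to sign; any other point is at displacement [D k - eta *: u i]. *)
have -> : \sum_ij potential fs r c
      (result (IFO fs) (saga_step (gradient r) eta s ij)) =
    n%:R * (\sum_i objective fs r (x - eta *: u i)) +
    c / n%:R * (n%:R * eta ^+ 2 * U + (n%:R - 1) *
      \sum_k \sum_i dotv (D k - eta *: u i) (D k - eta *: u i)).
  have -> : n%:R * eta ^+ 2 * U + (n%:R - 1) *
      \sum_k \sum_i dotv (D k - eta *: u i) (D k - eta *: u i) =
      \sum_i \sum_j \sum_k (if k == j then eta ^+ 2 * dotv (u i) (u i)
        else dotv (D k - eta *: u i) (D k - eta *: u i)).
    rewrite exchange_big /= !mulr_sumr -big_split /=; apply: eq_bigr => i _.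
    by rewrite sum_if_eq; ring.
  rewrite !mulr_sumr -big_split /=.
  pose P i j := potential fs r c
    (result (IFO fs) (saga_step (gradient r) eta s (i, j))).
  rewrite (eq_bigr (fun ij => P ij.1 ij.2)); last by case.
  rewrite -(pair_bigA _ P) /=.
  apply: eq_bigr => i _.
  rewrite -[n%:R * _]sumr_const_ord mulr_sumr -big_split /=.
  apply: eq_bigr => j _; rewrite /P /potential /= -/x -uiE.
  congr (_ + _ * _); apply: eq_bigr => k _.
  case: eqP => _; last by rewrite DE addrAC.
  by rewrite [x + _]addrC addrK !dotvE; ring.
have : \sum_k \sum_i dotv (D k - eta *: u i) (D k - eta *: u i) <=
    n%:R * (eta ^+ 2 * U + ((1 + eta * beta) * A + n%:R * (eta / beta * G))).
  apply: le_trans (ler_sum _ (fun k _ => dist_le k)) _.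
  rewrite big_split /= -!mulr_sumr big_split /= -!mulr_sumr !sumr_const_ord -/A.
  by rewrite le_eqVlt; apply/orP; left; apply/eqP; ring.
set S := \sum_k _ => S_le.
rewrite [X in _ * (X - _)]/potential -/x AE.
(* Naming the quotients [c / n%:R] and [eta / beta] leaves a polynomial inequality. *)
have [m m_gt0 cE] : exists2 m : R, 0 < m & c = m * n%:R.
  by exists (c / n%:R); [rewrite divr_gt0 ?ltr0n | rewrite divfK].
have [e e_gt0 eE] : exists2 e : R, 0 < e & eta / beta = e.
  by exists (eta / beta) => //; rewrite divr_gt0.
move: rateA rateG S_le; rewrite eE cE mulfK// => rateA rateG S_le.
set N := n%:R in n_ge1 rateA rateG S_le U_le obj_le cE *.
have N_ge0 : 0 <= N by lra.
have N1_ge0 : 0 <= N - 1 by lra.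
move: obj_le; set O := \sum_i objective _ _ _ => obj_le.
have h1 := ler_wpM2l N_ge0 obj_le.
have h2 := ler_wpM2l (mulr_ge0 (ltW m_gt0) N1_ge0) S_le.
have U_coef : 0 <= N * L * eta ^+ 2 + m * N * N * eta ^+ 2.
  by rewrite addr_ge0 // !mulr_ge0 ?(ltW L_gt0) ?(ltW m_gt0) ?(ltW eta_gt0).
have h3 := ler_wpM2l U_coef U_le.
have h4 := ler_wpM2r A_ge0 rateA.
have h5 := ler_wpM2r (mulr_ge0 (sqr_ge0 N) G_ge0) rateG.
(* [rateG] charges the Young term for all [n] values of [j], whereas only the [n - 1] that keep a
   given point incur it; [h6] is this excess. *)
have h6 : 0 <= m * N * e * N * G by rewrite !mulr_ge0 ?(ltW e_gt0) ?(ltW m_gt0).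
(* The claim is the sum of the inequalities [h1] to [h6]. *)
rewrite -subr_ge0 in h1; rewrite -subr_ge0 in h2; rewrite -subr_ge0 in h3.
rewrite -subr_ge0 in h4; rewrite -subr_ge0 in h5; rewrite -subr_ge0.
have := addr_ge0 (addr_ge0 (addr_ge0 h1 h2) (addr_ge0 h3 h4)) (addr_ge0 h5 h6).
by congr (_ <= _); field.
Qed.

(** * Execution of programs, oracle calls and the initial state *)

Lemma result_bind {Q S A B : Type} (o : Q -> S) (p : prog Q S A)
    (k : A -> prog Q S B) : result o (bind p k) = result o (k (result o p)).
Proof. by elim: p => [a|q c IH] //=. Qed.

Lemma calls_bind {Q S A B : Type} (o : Q -> S) (p : prog Q S A)
    (k : A -> prog Q S B) :
  calls o (bind p k) = (calls o p + calls o (k (result o p)))%N.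
Proof. by elim: p => [a|q c IH] //=; rewrite IH. Qed.

Lemma calls_query_gradients {R : realType} {n d : nat}
    (fs : 'I_n -> 'rV[R]_d -> R) (x : 'rV[R]_d) (s : seq 'I_n)
    (mem : 'I_n -> 'rV[R]_d) :
  calls (IFO fs) (query_gradients x s mem) = size s.
Proof. by elim: s mem => [|i s IHs] mem //=; rewrite IHs. Qed.

Lemma calls_saga_loop {R : realType} {n d : nat} (fs : 'I_n -> 'rV[R]_d -> R)
    (grad_r : 'rV[R]_d -> 'rV[R]_d) (eta : R) (s : saga_state R n d)
    (w : seq ('I_n * 'I_n)) :
  calls (IFO fs) (saga_loop grad_r eta s w) = (2 * size w)%N.
Proof.
elim: w s => [|[i j] w IHw] s //=.
by rewrite calls_bind IHw /= addn0 mulnS.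
Qed.

Lemma calls_reg_saga {R : realType} {n d : nat} (fs : 'I_n -> 'rV[R]_d -> R)
    (grad_r : 'rV[R]_d -> 'rV[R]_d) (x0 : 'rV[R]_d) (T : nat) (eta : R)
    (w : saga_random n T) :
  calls (IFO fs) (reg_saga grad_r x0 eta w) = (n + 2 * T)%N.
Proof.
rewrite /reg_saga /saga_init !calls_bind calls_query_gradients.
by rewrite calls_saga_loop /= size_tuple size_enum_ord !addn0.
Qed.

Lemma saga_init_ok {R : realType} {n d : nat} (fs : 'I_n -> 'rV[R]_d -> R)
    (x0 : 'rV[R]_d) : saga_mem_ok fs (result (IFO fs) (saga_init n x0)).
Proof.
split; first exact: saga_init_mem.
by rewrite /saga_init result_bind.
Qed.

Lemma potential_init {R : realType} {n d : nat} (fs : 'I_n -> 'rV[R]_d -> R)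
    (r : 'rV[R]_d -> R) (c : R) (x0 : 'rV[R]_d) :
  potential fs r c (result (IFO fs) (saga_init n x0)) = objective fs r x0.
Proof.
rewrite /potential /saga_init result_bind /= big1 ?mulr0 ?addr0// => k _.
by rewrite subrr -(scale0r (0 : 'rV[R]_d)) dotvZl mul0r.
Qed.

(** * Summation over whole runs *)

Lemma size_saga_loop {R : realType} {n d : nat} (fs : 'I_n -> 'rV[R]_d -> R)
    (grad_r : 'rV[R]_d -> 'rV[R]_d) (eta : R) (s : saga_state R n d)
    (w : seq ('I_n * 'I_n)) :
  size (result (IFO fs) (saga_loop grad_r eta s w)) = size w.
Proof.
elim: w s => [|ij w IHw] s //=.
by rewrite !result_bind /= IHw.
Qed.

(** Splits off the first pick, to match the recursion of [saga_loop]. *)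
Lemma big_tuple_cons {R : nmodType} {I : finType} {T : nat}
    (F : T.+1.-tuple I -> R) :
  \sum_(w : T.+1.-tuple I) F w = \sum_i \sum_(w : T.-tuple I) F (cons_tuple i w).
Proof.
rewrite pair_bigA (reindex (fun p : I * T.-tuple I => cons_tuple p.1 p.2))//=.
exists (fun w => (thead w, [tuple of behead w])) => [[i w] _|w _] /=.
  by congr pair; apply: val_inj.
by rewrite [RHS]tuple_eta; apply: val_inj.
Qed.

(** Telescoping by induction on [T] for an arbitrary valid state: the induction hypothesis handles
    the run after the first pick, and [potential_step] averages the resulting potentials over that
    pick. The factor [(n%:R ^+ 2) ^+ T] counts the pick sequences. *)
Lemma sum_saga_loop_le {R : realType} {n d : nat} (L q m : R)
    (fs : 'I_n -> 'rV[R]_d -> R) (r : 'rV[R]_d -> R) (T : nat)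
    (s : saga_state R n d) :
  0 < L -> (0 < n)%N -> 1 <= q -> q ^+ 3 = n%:R ->
  (forall i, L_smooth L (fs i)) -> L_smooth L r ->
  (forall y, m <= objective fs r y) -> saga_mem_ok fs s ->
  \sum_(w : T.-tuple ('I_n * 'I_n))
      \sum_(x <- result (IFO fs)
                   (saga_loop (gradient r) (4 * L * q ^+ 2)^-1 s w))
        enorm (gradient (objective fs r) x) ^+ 2 <=
    8 * L * q ^+ 2 * (n%:R ^+ 2) ^+ T * (potential fs r (L / (8 * q)) s - m).
Proof.
move=> L_gt0 n_gt0 q_ge1 qE sfs sr f_ge.
have q_gt0 : 0 < q by lra.
set eta := (4 * L * q ^+ 2)^-1; set c := L / (8 * q).
set K := 8 * L * q ^+ 2; set N := n%:R ^+ 2.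
have K_gt0 : 0 < K by rewrite !mulr_gt0.
have N_gt0 : 0 < N by rewrite exprn_gt0 ?ltr0n.
(* [K] is [2 / eta], so the drop of the potential pays exactly for the gradient at the current
   iterate. *)
have KetaE : K * (eta / 2) = 1.
  by rewrite /K /eta; field; rewrite !gt_eqF.
have pot_ge s' : m <= potential fs r c s'.
  rewrite /potential ler_wpDr//; apply: mulr_ge0.
    by rewrite !divr_ge0 ?mulr_ge0 ?(ltW L_gt0) ?(ltW q_gt0).
  by apply: sumr_ge0 => k _; exact: dotvv_ge0.
elim: T s => [|T IHT] s s_ok.
  rewrite (eq_bigr (fun=> 0)) => [|w _]; last by rewrite tuple0 big_nil.
  by rewrite big1// expr0 mulr1 mulr_ge0 ?subr_ge0// ltW.
rewrite big_tuple_cons.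
pose next ij := result (IFO fs) (saga_step (gradient r) eta s ij).
pose g x := enorm (gradient (objective fs r) x) ^+ 2.
apply: (@le_trans _ _ (\sum_ij (N ^+ T * g (st_x s)
    + K * N ^+ T * (potential fs r c (next ij) - m)))).
  apply: ler_sum => ij _.
  rewrite (eq_bigr (fun w : T.-tuple _ => g (st_x s) + \sum_(x <- result (IFO fs)
    (saga_loop (gradient r) eta (next ij) w)) g x)); last first.
    by move=> w _; rewrite /= !result_bind /= big_cons.
  rewrite big_split /= sumr_const card_tuple card_prod card_ord.
  rewrite -mulr_natl natrX natrM -expr2 lerD2l.
  exact: IHT (saga_step_ok fs (gradient r) eta s ij s_ok).
rewrite big_split /= sumr_const card_prod card_ord -mulr_natl natrM -expr2 -/N.
rewrite -mulr_sumr sumrB sumr_const card_prod card_ord -(mulr_natl m) natrM.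
rewrite -expr2 -/N.
have step := potential_step L q fs r s L_gt0 n_gt0 q_ge1 qE sfs sr s_ok.
have KT_ge0 : 0 <= K * N ^+ T by rewrite mulr_ge0 ?exprn_ge0// ltW.
apply: le_trans (_ : N * (N ^+ T * g (st_x s)) + K * N ^+ T *
  (N * (potential fs r c s - eta / 2 * g (st_x s)) - N * m) <= _).
  by rewrite lerD2l ler_wpM2l// lerD2r.
have -> : N * (N ^+ T * g (st_x s)) + K * N ^+ T *
  (N * (potential fs r c s - eta / 2 * g (st_x s)) - N * m) =
  N * (N ^+ T * g (st_x s)) * (1 - K * (eta / 2)) +
  K * N ^+ T.+1 * (potential fs r c s - m) by rewrite exprS; ring.
by rewrite KetaE subrr mulr0 add0r.
Qed.

(** Summing over the output index visits every iterate once. The list has length [T], so the default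
    [x0] of [nth] is never returned. *)
Lemma sum_reg_saga {R : realType} {n d : nat} (fs : 'I_n -> 'rV[R]_d -> R)
    (grad_r : 'rV[R]_d -> 'rV[R]_d) (x0 : 'rV[R]_d) (T : nat) (eta : R)
    (g : 'rV[R]_d -> R) :
  \sum_(w : saga_random n T) g (result (IFO fs) (reg_saga grad_r x0 eta w)) =
  \sum_(w : T.-tuple ('I_n * 'I_n))
    \sum_(x <- result (IFO fs)
        (saga_loop grad_r eta (result (IFO fs) (saga_init n x0)) w)) g x.
Proof.
pose xs (w : T.-tuple ('I_n * 'I_n)) := result (IFO fs)
  (saga_loop grad_r eta (result (IFO fs) (saga_init n x0)) w).
rewrite (eq_bigr (fun w : saga_random n T => g (nth x0 (xs w.1) w.2))); last first.
  by move=> w _; rewrite /xs /reg_saga /saga_init !result_bind.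
rewrite -(pair_bigA _ (fun w a => g (nth x0 (xs w) (nat_of_ord a)))) /=.
apply: eq_bigr => w _; rewrite [RHS](big_nth x0) size_saga_loop size_tuple.
by rewrite big_mkord.
Qed.

(** * Choice of the step size, the iteration count and the constant *)

Theorem theorem4 (R : realType) (L : R) (L_gt0 : 0 < L) :
  exists eta : nat -> R,
    (forall n : nat, (0 < n)%N -> 0 < eta n) /\
    forall Delta : R, exists C : R, 0 < C /\
      forall (n d : nat) (fs : 'I_n -> 'rV[R]_d -> R) (r : 'rV[R]_d -> R)
             (xstar x0 : 'rV[R]_d),
        (0 < n)%N ->
        (forall i, L_smooth L (fs i)) ->
        L_smooth L r ->
        (forall y, objective fs r xstar <= objective fs r y) ->
        objective fs r x0 - objective fs r xstar = Delta ->
        forall eps : R, 0 < eps ->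
          exists T : nat,
            [/\ (0 < T)%N,
                unif_mean (fun w : saga_random n T =>
                  enorm (gradient (objective fs r)
                    (result (IFO fs)
                      (reg_saga (gradient r) x0 (eta n) w))) ^+ 2) <= eps
              & forall w : saga_random n T,
                  (calls (IFO fs) (reg_saga (gradient r) x0 (eta n) w))%:R
                    <= C * (n%:R + n%:R `^ (2 / 3) / eps)].
Proof.
exists (fun n => (4 * L * (n%:R `^ 3^-1) ^+ 2)^-1); split=> [n n_gt0|Delta].
  by rewrite invr_gt0 !mulr_gt0 ?powR_gt0 ?ltr0n.
(* The run costs [n + 2 * T] calls with [T <= b / eps + 1]; the extra [2] is at most [2 * n], giving
   the [3], and [2 * b] gives [16 * L * Delta]. The absolute value keeps the constant positive for
   every [Delta]. *)
exists (3 + 16 * L * `|Delta|); split.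
  by rewrite ltr_wpDr// !mulr_ge0// ltW.
move=> n d fs r xstar x0 n_gt0 sfs sr xstar_min DeltaE eps eps_gt0.
have n_ge1 : 1 <= n%:R :> R by rewrite ler1n.
set q := n%:R `^ 3^-1.
have q3E : q ^+ 3 = n%:R.
  by rewrite -powR_mulrn ?powR_ge0// -powRrM mulVf// powRr1.
have q2E : n%:R `^ (2 / 3) = q ^+ 2.
  by rewrite -powR_mulrn ?powR_ge0// -powRrM mulrC.
have q_ge1 : 1 <= q by rewrite -[leLHS](powRr0 n%:R) ler_powR// invr_ge0.
have Delta_ge0 : 0 <= Delta by rewrite -DeltaE subr_ge0.
rewrite q2E (ger0_norm Delta_ge0).
set b := 8 * L * q ^+ 2 * Delta.
have b_ge0 : 0 <= b by rewrite !mulr_ge0 ?powR_ge0 ?(ltW L_gt0).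
have be_ge0 : 0 <= b / eps by rewrite divr_ge0// ltW.
(* The mean squared gradient is at most [b / T], so any [T] above [b / eps] works; the successor
   also ensures [0 < T] when [b = 0]. *)
pose T := (Num.truncn (b / eps)).+1; exists T.
have T_gt : b / eps < T%:R by exact: truncnS_gt.
have T_le : T%:R <= b / eps + 1 by rewrite -natr1 lerD2r truncn_le.
have T_gt0 : (0 < T)%N by [].
have bE : b = 8 * L * q ^+ 2 * Delta by [].
clearbody T b; split=> //; last first.
  move=> w; rewrite calls_reg_saga natrD natrM.
  have -> : (3 + 16 * L * Delta) * (n%:R + q ^+ 2 / eps) =
      3 * n%:R + 2 * (b / eps) + (3 * (q ^+ 2 / eps) + 16 * L * Delta * n%:R).
    by rewrite bE; field; rewrite gt_eqF.
  rewrite ler_wpDr//; last lra.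
  apply: addr_ge0; rewrite !mulr_ge0 ?invr_ge0 ?powR_ge0 ?(ltW eps_gt0) //.
  exact: ltW.
rewrite /unif_mean.
rewrite (sum_reg_saga fs (gradient r) x0 T _
  (fun x => enorm (gradient (objective fs r) x) ^+ 2)).
rewrite card_prod card_tuple card_prod !card_ord natrM natrX natrM -expr2.
have N_gt0 : 0 < (n%:R ^+ 2) ^+ T :> R by rewrite !exprn_gt0 ?ltr0n.
have TR_gt0 : 0 < T%:R :> R by rewrite ltr0n.
rewrite ler_pdivrMr ?mulr_gt0//.
apply: le_trans (sum_saga_loop_le L q (objective fs r xstar) fs r T _
  L_gt0 n_gt0 q_ge1 q3E sfs sr xstar_min (saga_init_ok fs x0)) _.
rewrite potential_init DeltaE.
have -> : 8 * L * q ^+ 2 * (n%:R ^+ 2) ^+ T * Delta = (n%:R ^+ 2) ^+ T * b.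
  by rewrite bE; ring.
rewrite [leRHS]mulrCA ler_pM2l//.
by rewrite ltW// -ltr_pdivrMl// mulrC.
Qed.
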